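(* If $G=(V,E)$ is a digraph such that $\widetilde G$ is locally finite, then $G\in\mathfrak{In}_2\text{-}\mathfrak{Out}_2$.
   Context: Digraphs $G=(V,E)$, $E\subseteq V\times V$, may be infinite (of any cardinality). The undirected complement of $G$ is the undirected graph $\widetilde G=(V,\widetilde E)$ where, for distinct $x,y\in V$, $\{x,y\}\in\widetilde E$ iff $(x,y)\notin E$ and $(y,x)\notin E$. An undirected graph is locally finite if every vertex has finite degree. For $W\subseteq V$, $G[W]=(W,E\cap (W\times W))$ is the induced subgraph. A set $A\subseteq V$ is independent if there is no edge (in either direction) of $G$ between two distinct elements of $A$. For $n\in\mathbb N$ and $A\subseteq V$, $\mathrm{Out}^G_n(A)$ (resp. $\mathrm{In}^G_n(A)$) is the set of all $v\in V$ such that there is a directed path of length at most $n$ from some point of $A$ to $v$ (resp. from $v$ to some point of $A$); length $0$ is allowed. $G\in\mathfrak{Out}_n$ (resp. $G\in\mathfrak{In}_n$) iff there is an independent $A\subseteq V$ with $V=\mathrm{Out}^G_n(A)$ (resp. $V=\mathrm{In}^G_n(A)$). $G\in\mathfrak{In}_n\text{-}\mathfrak{Out}_k$ iff there is a partition $(V_1,V_2)$ of $V$ (parts may be empty) with $G[V_1]\in\mathfrak{In}_n$ and $G[V_2]\in\mathfrak{Out}_k$. *)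

(* Defs.v *)
From mathcomp Require Import all_boot.
From mathcomp Require Import boolp classical_sets cardinality.

Set Implicit Arguments.
Unset Strict Implicit.
Unset Printing Implicit Defensive.

Local Open Scope classical_set_scope.

(* Loops and pairs of opposite edges are allowed. *)
Record digraph := Digraph {
  vertex :> Type;
  edge : vertex -> vertex -> Prop }.

Record ugraph := UGraph {
  uvertex :> Type;
  adj : uvertex -> uvertex -> Prop;
  adj_sym : forall x y, adj x y -> adj y x;
  adj_irrefl : forall x, ~ adj x x }.

Definition locally_finite (H : ugraph) : Prop :=
  forall x : H, finite_set [set y : H | adj x y].

Definition compl_adj (G : digraph) (x y : G) : Prop :=
  [/\ x <> y, ~ edge x y & ~ edge y x].

Lemma compl_adj_sym (G : digraph) (x y : G) : compl_adj x y -> compl_adj y x.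
Proof. by case=> nxy nE nE'; split=> // eyx; apply: nxy. Qed.

Lemma compl_adj_irrefl (G : digraph) (x : G) : ~ compl_adj x x.
Proof. by case. Qed.

Definition undirected_complement (G : digraph) : ugraph :=
  UGraph (@compl_adj_sym G) (@compl_adj_irrefl G).

Definition induced (G : digraph) (W : set G) : digraph :=
  @Digraph (set_type W) (fun x y => edge (val x) (val y)).

(* Both directions are covered, since x and y range over all of A. *)
Definition independent (G : digraph) (A : set G) : Prop :=
  forall x y : G, A x -> A y -> x <> y -> ~ edge x y.

(* The vertices of the path are p 0, ..., p k; values of p beyond k are
   irrelevant. *)
Definition dipath (G : digraph) (k : nat) (p : nat -> G) (x y : G) : Prop :=
  [/\ p 0 = x, p k = y,
      forall i, i < k -> edge (p i) (p i.+1)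
    & forall i j, i <= k -> j <= k -> p i = p j -> i = j].

Definition reach_within (G : digraph) (n : nat) (x y : G) : Prop :=
  exists k p, k <= n /\ dipath k p x y.

Definition Out_set (G : digraph) (n : nat) (A : set G) : set G :=
  [set v | exists2 a, A a & reach_within n a v].

Definition In_set (G : digraph) (n : nat) (A : set G) : set G :=
  [set v | exists2 a, A a & reach_within n v a].

Definition Out_class (n : nat) (G : digraph) : Prop :=
  exists A : set G, independent A /\ Out_set n A = setT.

Definition In_class (n : nat) (G : digraph) : Prop :=
  exists A : set G, independent A /\ In_set n A = setT.

Definition In_Out_class (n k : nat) (G : digraph) : Prop :=
  exists V1 V2 : set G,
    [/\ V1 `|` V2 = setT, V1 `&` V2 = set0,
        In_class n (induced V1) & Out_class k (induced V2)].

(* Main.v *)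
Require Import Defs.
From mathcomp Require Import all_boot.
From mathcomp Require Import boolp classical_sets cardinality.

(** If every vertex reaches every vertex by a path of length at most 2, any single
  vertex is a quasi-kernel of G. Otherwise there are x and y with no path of length
  at most 2 from x to y. Let V1 consist of x and its in-neighbours, without y,
  and let V2 be the rest: {x} is a quasi-sink of G[V1]. A vertex v of V2 that is
  neither y nor an out-neighbour of y is a non-neighbour of x or of y, for
  otherwise x -> v -> y; so there are finitely many such v. These
  finitely many vertices induce a graph with a quasi-kernel, and the
  Chvátal-Lovász exchange step at y extends it to a quasi-kernel of G[V2]. *)

Local Open Scope classical_set_scope.

(** Walks instead of paths, with the middle vertex confined to [W]: induced subgraphs can then be
    treated as subsets of [G], without subtypes. *)
Definition reach2 {G : digraph} (W : set G) (x y : G) : Prop :=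
  [\/ x = y, edge x y | exists2 z, W z & edge x z /\ edge z y].

Definition quasi_kernel {G : digraph} (W K : set G) : Prop :=
  [/\ K `<=` W, independent K & forall w, W w -> exists2 k, K k & reach2 W k w].

Lemma reach2W {G : digraph} {W W' : set G} {x y : G} :
  W `<=` W' -> reach2 W x y -> reach2 W' x y.
Proof.
move=> sWW' [->|exy|[z /sWW' Wz exzy]]; first exact: Or31.
  exact: Or32.
by apply: Or33; exists z.
Qed.

Lemma dipath0 {G : digraph} (x : G) : dipath 0 (fun=> x) x x.
Proof. by split=> // i j; rewrite !leqn0 => /eqP-> /eqP->. Qed.

Lemma dipath1 {G : digraph} (x y : G) :
  x <> y -> edge x y -> dipath 1 (fun i => if i is 0 then x else y) x y.
Proof.
move=> nxy exy; split=> //; first by case.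
by move=> [|[|//]] [|[|//]] // _ _ /esym.
Qed.

Lemma dipath2 {G : digraph} (x z y : G) :
  x <> z -> z <> y -> x <> y -> edge x z -> edge z y ->
  dipath 2 (fun i => match i with 0 => x | 1 => z | _ => y end) x y.
Proof.
move=> nxz nzy nxy exz ezy; split=> //; first by case=> [|[|]].
by move=> [|[|[|//]]] [|[|[|//]]] // _ _ /esym.
Qed.

(** Since [dipath] forbids repeated vertices, a walk whose middle vertex equals an endpoint is
    shortened to a single edge. *)
Lemma reach2_within {G : digraph} (x y : G) :
  reach2 setT x y -> reach_within 2 x y.
Proof.
have [-> _|nxy] := pselect (x = y).
  by exists 0, (fun=> y); split=> //; apply: dipath0.
have base : edge x y -> reach_within 2 x y.
  by move=> exy; eexists 1, _; split=> //; apply: dipath1 nxy exy.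
case=> [//|//|[z _ [exz ezy]]].
have [xz|nxz] := pselect (x = z); first by apply: base; rewrite xz.
have [zy|nzy] := pselect (z = y); first by apply: base; rewrite -zy.
by eexists 2, _; split=> //; apply: dipath2 nxz nzy nxy exz ezy.
Qed.

Lemma Out_class_quasi_kernel {G : digraph} {W K : set G} :
  quasi_kernel W K -> Out_class 2 (induced W).
Proof.
move=> [sKW indK domK]; exists [set u | K (val u)]; split.
  move=> u v Ku Kv nuv; apply: indK => // /val_inj; exact: nuv.
apply/seteqP; split=> // w _.
have [k Kk kw] := domK _ (set_mem (valP w)).
exists (exist _ k (mem_set (sKW _ Kk))) => //; apply: reach2_within.
case: kw => [kw|kw|[z Wz kzw]]; first by apply: Or31; apply: val_inj.
  exact: Or32.
by apply: Or33; exists (exist _ z (mem_set Wz)).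
Qed.

(* Chvátal-Lovász: if some k in K dominates y, then k reaches the out-neighbours
   of y in two steps and K suffices; otherwise y can be added to K. *)
Lemma quasi_kernel_extend {G : digraph} {W K : set G} {y : G} :
  W y -> quasi_kernel [set v | [/\ W v, v <> y & ~ edge y v]] K ->
  exists K', quasi_kernel W K'.
Proof.
set F := [set v | _] => Wy [sKF indK domK].
have sFW : F `<=` W by move=> v [].
have sKW := subset_trans sKF sFW.
have domF w : F w -> exists2 k, K k & reach2 W k w.
  by move=> /domK[k Kk kw]; exists k => //; apply: reach2W kw.
have splitW w : W w -> [\/ F w, w = y | edge y w].
  move=> Ww; have [->|nwy] := pselect (w = y); first exact: Or32.
  by have [eyw|nyw] := pselect (edge y w); [apply: Or33|apply: Or31].
have [[k Kk eky]|nKy] := pselect (exists2 k, K k & edge k y).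
  exists K; split=> // w /splitW[/domF //|->|eyw]; exists k => //.
    exact: Or32.
  by apply: Or33; exists y.
exists (y |` K); split.
- by move=> v [->|/sKW].
(* Edges from [y] into [K] are excluded by [F], edges from [K] to [y] by [nKy]. *)
- move=> u v [->|Ku] [->|Kv] //.
  + by move=> _; have [] := sKF _ Kv.
  + by move=> _ euy; apply: nKy; exists u.
  + exact: indK.
- move=> w /splitW[/domF[k Kk kw]|->|eyw]; first by exists k => //; right.
    by exists y; [left|apply: Or31].
  by exists y; [left|apply: Or32].
Qed.

(** Induction: remove a vertex [a] of [W] with its out-neighbours, then apply the exchange step at
    [a]. *)
Lemma finite_quasi_kernel {G : digraph} (W : set G) :
  finite_set W -> exists K, quasi_kernel W K.
Proof.
move=> /(@finite_seqP {classic G})[s Ws].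
(* Inclusion, unlike equality, lets the induction hypothesis apply to whatever part of [W] is
   left. *)
have : W `<=` [set` s] by rewrite Ws.
elim: s {Ws} W => [|a s IHs] W sWs; first by exists set0; split=> // w /sWs.
have [Wa|nWa] := pselect (W a); last first.
  apply: IHs => w Ww; have /= := sWs _ Ww.
  by rewrite in_cons => /orP[/eqP wa|//]; case: nWa; rewrite -wa.
have [|K qK] := IHs [set v | [/\ W v, v <> a & ~ edge a v]].
  by move=> v [/sWs /=]; rewrite in_cons => /orP[/eqP|].
exact: quasi_kernel_extend Wa qK.
Qed.

Lemma In_class_star {G : digraph} {W : set G} {x : G} :
  W x -> (forall v, W v -> v = x \/ edge v x) -> In_class 2 (induced W).
Proof.
move=> Wx Wdom; pose xW : induced W := exist _ x (mem_set Wx).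
exists [set xW]; split; first by move=> u v -> ->.
apply/seteqP; split=> // v _; exists xW => //; apply: reach2_within.
have [vx|evx] := Wdom _ (set_mem (valP v)); last exact: Or32.
by apply: Or31; apply: val_inj.
Qed.

Lemma In_class_set0 {G : digraph} (n : nat) : In_class n (@induced G set0).
Proof.
exists set0; split=> //; apply/seteqP; split=> // v _.
by have := set_mem (valP v).
Qed.

Lemma In_Out_class_quasi_kernel {G : digraph} {V1 K : set G} :
  In_class 2 (induced V1) -> quasi_kernel (~` V1) K -> In_Out_class 2 2 G.
Proof.
move=> inV1 qK; exists V1, (~` V1); split=> //.
- exact: setUv.
- exact: setICr.
- exact: Out_class_quasi_kernel qK.
Qed.

Theorem theorem3p5 (G : digraph)
    (hG : locally_finite (undirected_complement G)) :
  In_Out_class 2 2 G.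
Proof.
have [reachG|/existsNP[x /existsNP[y nxy]]] :=
    pselect (forall x y : G, reach2 setT x y).
  (* Here [V1] is empty. A singleton serves as [K], or the empty set if [G] has no vertex. *)
  have [K qK] : exists K, quasi_kernel (~` (set0 : set G)) K.
    have [[x _]|nG] := pselect (exists x : G, True).
      exists [set x]; split; first by move=> v _ [].
        by move=> u v -> ->.
      by move=> w _; exists x => //; rewrite setC0.
    by exists set0; split=> // w; case: nG; exists w.
  exact: In_Out_class_quasi_kernel (In_class_set0 2) qK.
(* Even if [y] is an in-neighbour of [x], it must stay in [V2] for the exchange step. *)
pose V1 : set G := [set v | v <> y /\ (v = x \/ edge v x)].
have nexy : x <> y by move=> xy; apply: nxy; apply: Or31.
have V1x : V1 x by split=> //; left.
have V2y : (~` V1) y by case.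
have [|K qK] :=
    finite_quasi_kernel [set v | [/\ (~` V1) v, v <> y & ~ edge y v]].
  apply: (@sub_finite_set _ _
    ([set v | compl_adj x v] `|` [set v | compl_adj y v])).
    move=> v [nV1v nvy neyv].
    have nvx : v <> x by move=> vx; apply: nV1v; split=> //; left.
    have nevx : ~ edge v x by move=> evx; apply: nV1v; split=> //; right.
    have [exv|nexv] := pselect (edge x v); last by left; split=> // /esym.
    right; split=> //; first by move=> /esym.
    by move=> evy; apply: nxy; apply: Or33; exists v.
  by rewrite finite_setU; split; apply: hG.
have [K' qK'] := quasi_kernel_extend V2y qK.
by apply: In_Out_class_quasi_kernel qK'; apply: In_class_star V1x _ => v [].
Qed.
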